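(* Let $f:\mathbb{N}\to\mathbb{R}$ be an additive function and $0<\epsilon<1$. Suppose there are a set of primes $\mathcal{P}$, a real number $M\ge2$ and constants $C_1,C_2>0$ such that \[ \sum_{p\text{ prime},\,p\notin\mathcal{P}}\frac1p\le C_1\qquad\text{and}\qquad\sum_{p\in\mathcal{P},\,p>M}\frac{|f(p)|}{p}\le C_2\,\epsilon. \] Then there is a constant $\kappa>0$ depending only on $C_1$ and $C_2$ such that for every $y\ge M$, \[ Q_{\mathcal{F}_y}(\epsilon)\ge\frac{\kappa}{\log M}. \]
   Context: A function $f:\mathbb{N}\to\mathbb{R}$ is additive if $f(mn)=f(m)+f(n)$ whenever $\gcd(m,n)=1$. For $y\ge1$ define \[ \mathcal{F}_y(u)=\prod_{p\le y}\left(1-\frac1p\right)\sum_{\substack{n\ge1:\ p\mid n\Rightarrow p\le y\\ f(n)\le u}}\frac1n\qquad(u\in\mathbb{R}), \] where $p$ runs over primes. For a distribution function $G$, its concentration function is $Q_G(\epsilon)=\sup_{u\in\mathbb{R}}\{G(u+\epsilon)-G(u)\}$. *)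

(* Defs.v *)
From HB Require Import structures.
From mathcomp Require Import all_boot all_order all_algebra.
From mathcomp Require Import all_classical all_reals all_analysis.

Set Implicit Arguments.
Unset Strict Implicit.
Unset Printing Implicit Defensive.

Import Order.TTheory GRing.Theory Num.Theory.
Local Open Scope classical_set_scope.
Local Open Scope ring_scope.

(* The domain is the positive integers: the value f 0 plays no role. *)
Definition additive_arith (R : realType) (f : nat -> R) : Prop :=
  forall m n : nat, (0 < m)%N -> (0 < n)%N -> coprime m n ->
    f (m * n)%N = f m + f n.

Definition smooth_nat (R : realType) (y : R) : set nat :=
  [set n | (0 < n)%N /\ forall p : nat, prime p -> (p %| n)%N -> p%:R <= y].

(* For y >= 0 a natural number p satisfies p%:R <= y iff p <= Num.truncn y.
   The sum is dominated by the (finite) Euler product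
   \prod_(p <= y) (1 - 1/p)^-1, so [fine] never meets +oo. *)
Definition smooth_distr (R : realType) (f : nat -> R) (y u : R) : R :=
  (\prod_(p < (Num.truncn y).+1 | prime p) (1 - (p%:R)^-1)) *
  fine (\esum_(n in smooth_nat y `&` [set n | f n <= u]) ((n%:R : R)^-1)%:E).

(* For G a distribution function the set below is nonempty and bounded by 1,
   so the real-valued [sup] is the actual supremum. *)
Definition concentration (R : realType) (G : R -> R) (eps : R) : R :=
  sup [set G (u + eps) - G u | u in [set: R]].

(* Main.v *)
Require Import Defs.
From HB Require Import structures.
From mathcomp Require Import all_boot all_order all_algebra.
From mathcomp Require Import all_classical all_reals all_analysis.
From mathcomp Require Import ring lra zify.

Set Implicit Arguments.
Unset Strict Implicit.
Unset Printing Implicit Defensive.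

Import Order.TTheory GRing.Theory Num.Theory.
Local Open Scope classical_set_scope.
Local Open Scope ring_scope.

(* Weight n by 1/n.  Among the y-smooth n keep only the squarefree products of
   primes p in P with M < p <= y.  Comparing Euler products, they carry a
   proportion of the total mass at least
     exp (- \sum_(p <= M) 1/p - C1 - O(1)) >> 1 / ln M,
   by the upper bound \sum_(p <= x) 1/p <= ln (ln x) + O(1) of Mertens.  On them
   the mean of |f n| is at most the sum of |f p| / p, that is at most C2 eps, so
   by Markov half of this mass has |f n| < L eps with L > 2 C2.  The interval
   from - L eps to L eps splits into 2 L intervals of length eps. *)

(** * Chebyshev-type bounds for products over primes *)

Section PrimePowerProducts.
Local Open Scope nat_scope.

Lemma prod_prime_powers_dvd (e : nat -> nat) (N m n : nat) :
  (forall p, m <= p < n -> prime p -> p ^ e p %| N) ->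
  \prod_(m <= p < n | prime p) p ^ e p %| N.
Proof.
move=> h; have [nm|] := leqP n m; first by rewrite big_geq.
elim: n h => // n IH h; rewrite ltnS => lemn.
rewrite big_mkcond big_nat_recr //= -big_mkcond /=.
have {}IH : \prod_(m <= p < n | prime p) p ^ e p %| N.
  have [nm|mn] := leqP n m; first by rewrite big_geq.
  by apply: IH => // p /andP[lemp ltpn]; apply: h; rewrite lemp leqW.
case: ifP => [pn|_]; last by rewrite muln1.
rewrite Gauss_dvd ?IH ?h ?lemn //=.
rewrite big_nat_cond; apply: (big_rec (fun k => coprime k _)) => [|p x].
  exact: coprime1n.
move=> /andP[/andP[_ ltpn] pp] cx.
rewrite coprimeMl cx andbT coprimeXl // coprimeXr // prime_coprime //.
by rewrite dvdn_prime2 // ltn_eqF.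
Qed.

(** Chebyshev's argument by strong induction: the primes in the upper half of the range divide a
    central binomial coefficient, which is at most a power of 2. Base 16 absorbs the rounding of the
    half: [4 * k <= 3 * m] for [k = uphalf m] and [m >= 2]. *)
Lemma primorial_le (n : nat) : \prod_(0 <= p < n.+1 | prime p) p <= 16 ^ n.
Proof.
elim/ltn_ind: n => -[|[|n]] IH.
- by rewrite big_mkcond big_nat1.
- by rewrite big_mkcond /= !big_nat_recl // big_geq.
set m := n.+2; pose k := uphalf m.
have km : k <= m by rewrite /k; lia.
rewrite (@big_cat_nat _ _ _ k.+1) //=.
have h1 : \prod_(k.+1 <= p < m.+1 | prime p) p <= 2 ^ m.
  apply: (@leq_trans 'C(m, k)).
    rewrite dvdn_leq ?bin_gt0 //.
    apply: (@prod_prime_powers_dvd (fun=> 1)) => p /andP[kp pm] pp.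
    rewrite expn1.
    have : p %| m`! by rewrite dvdn_fact // prime_gt0.
    rewrite -(bin_fact km) Euclid_dvdM // (Euclid_dvdM k`!) //.
    (* A prime above [j] divides no factor of [j!]. Both [k] and [m - k] are below [p], so the
       factor [p] of [m!] must sit in the binomial coefficient. *)
    have ndvd j : j < p -> p %| j`! = false.
      move=> ltjp; apply: contraTF ltjp; rewrite -leqNgt fact_prod big_nat_cond.
      elim/big_rec: _ => [|i x /andP[/andP[i0 ij] _] ihx].
        by rewrite dvdn1 => /eqP p1; rewrite p1 in pp.
      by rewrite Euclid_dvdM // => /orP[/dvdn_leq|//]; lia.
    rewrite (ndvd k kp) (ndvd (m - k)%N) ?orbF //; rewrite /k in kp *; lia.
  rewrite -[2]/(1 + 1) expnDn (bigD1 (inord k)) //= inordK ?ltnS //.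
  by rewrite !exp1n !muln1 leq_addr.
apply: leq_trans (leq_mul (IH k _) h1) _; first by rewrite /k; lia.
rewrite -[16]/(2 ^ 4) -!expnM -expnD leq_exp2l // /k; lia.
Qed.

(** In Legendre's formula the first term [n %/ p] already bounds the exponent of [p] in [n!] from
    below, so the product divides [n!]. *)
Lemma prod_prime_divn_le (n : nat) :
  \prod_(0 <= p < n.+1 | prime p) p ^ (n %/ p) <= n ^ n.
Proof.
apply: (@leq_trans n`!); last first.
  rewrite fact_prod big_nat -[X in _ <= _ ^ X]card_ord -prod_nat_const.
  rewrite -[X in X <= _]big_nat big_add1 big_mkord.
  exact: leq_prod.
apply/dvdn_leq/prod_prime_powers_dvd => [|p /andP[_ pn] pp].
  exact: fact_gt0.
rewrite pfactor_dvdn ?fact_gt0 // logn_fact //.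
case: n pn => [|n] pn; first by rewrite div0n.
by rewrite big_nat_recl // expn1 leq_addr.
Qed.

End PrimePowerProducts.

(** * Mertens' upper bounds for sums over primes *)

Lemma ln_prod_nat (R : realType) (n : nat) (P : pred nat) (F : nat -> nat) :
  (forall i, P i -> (0 < F i)%N) ->
  ln ((\prod_(0 <= i < n | P i) F i)%N%:R : R) =
  \sum_(0 <= i < n | P i) ln (F i)%:R.
Proof.
move=> F0.
apply: (@proj2 (0 < \prod_(0 <= i < n | P i) F i)%N).
elim/big_rec2: _ => [|i x y Pi [y0 <-]]; first by rewrite ln1.
rewrite muln_gt0 F0 // y0 natrM lnM // posrE ltr0n //; exact: F0.
Qed.

(* Only floors enter the factorisation of n!; replacing n %/ p by n / p costs
   the sum of ln p over p <= n, which is O(n). *)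
Lemma sum_ln_prime_div_le (R : realType) (n : nat) : (0 < n)%N ->
  \sum_(0 <= p < n.+1 | prime p) ln (p%:R : R) / p%:R <= ln n%:R + ln 16.
Proof.
move=> n0; have n0R : 0 < n%:R :> R by rewrite ltr0n.
have theta : \sum_(0 <= p < n.+1 | prime p) ln (p%:R : R) <= n%:R * ln 16.
  rewrite -ln_prod_nat; last exact: prime_gt0.
  rewrite mulr_natl -lnXn // -natrX ler_ln ?posrE ?ltr0n ?expn_gt0 //.
    by rewrite ler_nat primorial_le.
  by apply: prodn_cond_gt0 => i; exact: prime_gt0.
have flr : \sum_(0 <= p < n.+1 | prime p) (n %/ p)%:R * ln (p%:R : R)
    <= n%:R * ln n%:R.
  under eq_bigr => p pp do
    rewrite mulr_natl -lnXn ?ltr0n ?prime_gt0 // -natrX.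
  rewrite -ln_prod_nat; last by move=> i /prime_gt0 i0; rewrite expn_gt0 i0.
  rewrite mulr_natl -lnXn // -natrX ler_ln ?posrE ?ltr0n ?expn_gt0 ?n0 //.
    by rewrite ler_nat prod_prime_divn_le.
  by apply: prodn_cond_gt0 => i /prime_gt0 i0; rewrite expn_gt0 i0.
rewrite -(ler_pM2l n0R) mulrDr; apply: le_trans (lerD flr theta).
rewrite -big_split mulr_sumr /=; apply: ler_sum => p pp.
have p0 : 0 < p%:R :> R by rewrite ltr0n prime_gt0.
have l0 : 0 <= ln (p%:R : R) by rewrite ln_ge0 // ler1n prime_gt0.
rewrite mulrCA mulrC -[X in _ <= _ + X]mul1r -mulrDl ler_wpM2r //.
rewrite ler_pdivrMr // natr1 -natrM ler_nat -ltnS.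
by rewrite mulnC (leq_trans _ (leqnSn _)) // mulnC ltn_ceil // prime_gt0.
Qed.

(* Abel summation of 1/p = (ln p / p) * (1 / ln p): the induction bounds the
   part left after removing the boundary term S n / ln n, and the increments
   1 - ln n / ln (n + 1) are at most those of ln (ln n). *)
Lemma sum_prime_inv_le (R : realType) (n : nat) : (2 <= n)%N ->
  \sum_(0 <= p < n.+1 | prime p) (p%:R : R)^-1 <=
  ln (ln n%:R) + (1 + ln 16 / ln 2 - ln (ln 2)).
Proof.
pose S n := \sum_(0 <= p < n.+1 | prime p) ln (p%:R : R) / p%:R.
pose T n := \sum_(0 <= p < n.+1 | prime p) (p%:R : R)^-1.
have recr (F : nat -> R) k : \sum_(0 <= p < k.+2 | prime p) F p =
    \sum_(0 <= p < k.+1 | prime p) F p + (if prime k.+1 then F k.+1 else 0).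
  by rewrite big_mkcond big_nat_recr //= -big_mkcond.
have s2 (F : nat -> R) : \sum_(0 <= p < 3 | prime p) F p = F 2%N.
  by rewrite !recr big_mkcond big_nat1 /= !add0r.
have l_gt0 k : (2 <= k)%N -> 0 < ln (k%:R : R).
  by move=> k2; rewrite ln_gt0 // ltr1n.
have C0 : 0 < ln (16 : R) by rewrite ln_gt0 // ltr1n.
move=> n2; have [Sn ln0] := (sum_ln_prime_div_le R (ltnW n2), l_gt0 n n2).
suff h : T n - S n / ln n%:R <=
    ln (ln n%:R) - ln (ln 2) + ln 16 * ((ln 2)^-1 - (ln n%:R)^-1).
  have : S n / ln n%:R <= 1 + ln 16 / ln n%:R.
    rewrite -[X in X + _](divff (lt0r_neq0 ln0)) -mulrDl.
    by rewrite ler_wpM2r // invr_ge0 ltW.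
  by move: h; rewrite -/(T n); lra.
elim: n n2 {Sn ln0} => // n IH; rewrite leq_eqVlt => /predU1P[[<-]|n2].
  have -> : S 2 = ln 2 * T 2.
    by rewrite /S /T !s2.
  by rewrite mulrAC divff ?mul1r ?lt0r_neq0 ?l_gt0 // !subrr mulr0 addr0.
have {}IH := IH n2.
have ln0 := l_gt0 n n2; have lS0 := l_gt0 n.+1 (ltnW n2).
(* If [n.+1] is prime it adds its inverse both to [T] and to the quotient of [S] by [ln n.+1]; these
   cancel, and only the divisor of [S n] changes. *)
have -> : T n.+1 - S n.+1 / ln n.+1%:R = T n - S n / ln n.+1%:R.
  rewrite /T /S !recr; case: ifP => _; last by rewrite !addr0.
  rewrite mulrDl [ln _ / _ / ln _]mulrAC divff ?lt0r_neq0 // mul1r.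
  by rewrite opprD addrACA subrr addr0.
have lnS : ln (n%:R : R) <= ln n.+1%:R.
  by rewrite ler_ln ?posrE ?ltr0n ?ler_nat // ltnW.
have dinv : 0 <= (ln n%:R)^-1 - (ln (n.+1%:R : R))^-1.
  by rewrite subr_ge0 lef_pV2 ?posrE.
have Sn : S n * ((ln n%:R)^-1 - (ln n.+1%:R)^-1) <=
    (ln n%:R + ln 16) * ((ln n%:R)^-1 - (ln n.+1%:R)^-1).
  by rewrite ler_wpM2r // sum_ln_prime_div_le // ltnW.
(* This is [ln (1 + x) <= x] at [x = ln n / ln (n + 1) - 1]. *)
have lnln : 1 - ln n%:R / ln (n.+1%:R : R) <= ln (ln n.+1%:R) - ln (ln n%:R).
  have := @le_ln1Dx R (ln n%:R / ln n.+1%:R - 1).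
  rewrite subrKC ln_div ?posrE // => h.
  have : -1 < ln (n%:R : R) / ln n.+1%:R - 1.
    by rewrite ltrBrDr addNr divr_gt0.
  by move/h; lra.
move: Sn IH; rewrite !mulrBr !mulrDl divff ?lt0r_neq0 //; lra.
Qed.

(** * Comparison of Euler products *)

(** Take inverses in [1 / (1 - x) = 1 + x / (1 - x) <= expR (x / (1 - x))]. *)
Lemma expR_div1B_le (R : realType) (x : R) : 0 <= x -> x < 1 ->
  expR (- (x / (1 - x))) <= 1 - x.
Proof.
move=> x0 x1; have y0 : 0 < 1 - x by rewrite subr_gt0.
rewrite expRN -[leRHS]invrK lef_pV2 ?posrE ?expR_gt0 ?invr_gt0 //.
apply: le_trans (expR_ge1Dx _).
rewrite le_eqVlt; apply/orP; left; apply/eqP; field; lra.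
Qed.

(** With [b] false the exponent is exactly [- 1 / (p - 1)]. With [b] true the factor is
    [1 - 1 / p^2], and [1 / (p^2 - 1) <= 1 / (p (p - 1))]. The error is written as
    [1 / (p - 1) - 1 / p] so that it telescopes. *)
Lemma euler_factor_ge (R : realType) (p : nat) (b : bool) : (2 <= p)%N ->
  expR (- ((if b then 0 else (p%:R)^-1) + ((p.-1%:R)^-1 - (p%:R)^-1))) <=
  (1 - (p%:R : R)^-1) * (if b then 1 + (p%:R)^-1 else 1).
Proof.
move=> p2; have pR : 2 <= p%:R :> R by rewrite ler_nat.
have -> : p.-1%:R = p%:R - 1 :> R by rewrite -subn1 natrB // ltnW.
set x := p%:R in pR *.
have x1 : x^-1 <= 2^-1 by rewrite lef_pV2 ?posrE //; lra.
have x0 : 0 < x^-1 by rewrite invr_gt0; lra.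
case: b; last first.
  rewrite mulr1; apply: le_trans (expR_div1B_le _ _); [|lra..].
  rewrite ler_expR lerN2 le_eqVlt; apply/orP; left; apply/eqP; field; lra.
have -> : (1 - x^-1) * (1 + x^-1) = 1 - x^-1 ^+ 2 by ring.
have xx : x^-1 ^+ 2 <= 2^-1 by nra.
apply: le_trans (expR_div1B_le _ _); [|nra..].
rewrite ler_expR lerN2 add0r.
have -> : x^-1 ^+ 2 / (1 - x^-1 ^+ 2) = (x - 1)^-1 * (x + 1)^-1.
  by field; nra.
have -> : (x - 1)^-1 - x^-1 = (x - 1)^-1 * x^-1 by field; nra.
by rewrite ler_wpM2l ?invr_ge0 ?lef_pV2 ?posrE; lra.
Qed.

Lemma euler_prod_ge (R : realType) (n : nat) (T : pred nat) :
  expR (- (\sum_(0 <= p < n | prime p && ~~ T p) (p%:R : R)^-1 + 1)) <=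
  (\prod_(0 <= p < n | prime p) (1 - (p%:R)^-1)) *
  \prod_(0 <= p < n | prime p && T p) (1 + (p%:R : R)^-1).
Proof.
(* The terms are nonnegative from 2 on, so the sum may be extended from primes to all integers
   [>= 2], where it telescopes. *)
have tel : \sum_(0 <= p < n | prime p) ((p.-1%:R)^-1 - (p%:R)^-1) <= 1 :> R.
  case: n => [|[|n]]; first by rewrite big_geq.
    by rewrite big_mkcond big_nat1.
  rewrite big_mkcond.
  rewrite !big_nat_recl //= !add0r.
  apply: (@le_trans _ _
      (\sum_(0 <= i < n) (- (i.+2%:R : R)^-1 - - (i.+1%:R)^-1))).
    apply: ler_sum => i _; case: ifP => _; first by rewrite opprK addrC.
    by rewrite opprK addrC subr_ge0 lef_pV2 ?posrE ?ltr0n // ler_nat.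
  rewrite (@telescope_sumr _ _ _ (fun i => - (i.+1%:R : R)^-1)) //.
  by rewrite invr1 opprK gerDr oppr_le0 invr_ge0.
rewrite !big_mkcondr -big_split /=.
apply: (@le_trans _ _ (\prod_(0 <= p < n | prime p)
   expR (- ((if T p then 0 else (p%:R)^-1) + ((p.-1%:R)^-1 - (p%:R)^-1))))).
  rewrite -expR_sum ler_expR sumrN lerN2 big_split /= lerD //.
  by apply: ler_sum => p _; case: (T p).
apply: ler_prod => p pp; rewrite expR_ge0 /=.
exact: euler_factor_ge (prime_gt1 pp).
Qed.

(** * Additive functions on products of distinct primes *)

Lemma additive_arith1 (R : realType) (f : nat -> R) :
  additive_arith f -> f 1%N = 0.
Proof.
by move=> /(_ 1%N 1%N isT isT isT)/eqP; rewrite -subr_eq0 muln1 opprD addrA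
  subrr sub0r oppr_eq0 => /eqP.
Qed.

Lemma additive_arith_prod_primes (R : realType) (f : nat -> R) (s : seq nat) :
  additive_arith f -> uniq s -> all prime s ->
  f (\prod_(p <- s) p)%N = \sum_(p <- s) f p.
Proof.
move=> fadd; elim: s => [|p s IH] /=; first by rewrite !big_nil additive_arith1.
move=> /andP[ps us] /andP[pp sp]; rewrite !big_cons fadd ?IH ?(prime_gt0 pp) //.
  by rewrite big_seq; apply: prodn_cond_gt0 => q /(allP sp)/prime_gt0.
rewrite big_seq; elim/big_rec: _ => [|q x qs cx]; first exact: coprimen1.
rewrite coprimeMr cx andbT prime_coprime // dvdn_prime2 ?(allP sp q qs) //.
by apply: contraNneq ps => ->.
Qed.

Lemma prime_dvd_prod_primes (p : nat) (s : seq nat) :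
  prime p -> all prime s -> (p %| \prod_(q <- s) q)%N = (p \in s).
Proof.
move=> pp; elim: s => [|q s IH] /=.
  by rewrite big_nil dvdn1 eqn_leq leqNgt prime_gt1.
by move=> /andP[qp sp]; rewrite big_cons Euclid_dvdM // IH // dvdn_prime2.
Qed.

(** * A Markov inequality for random subsets *)

Section RandomSubset.
Variables (R : realType) (I : finType) (a g : I -> R).
Hypotheses (a0 : forall i, 0 <= a i) (g0 : forall i, 0 <= g i).

(** This is the normalising constant of the random subset that contains each [i] independently with
    probability [a i / (1 + a i)]. *)
Lemma sum_prod_subsets :
  \sum_(J : {set I}) \prod_(i in J) a i = \prod_i (1 + a i).
Proof.
under [RHS]eq_bigr do rewrite addrC.
by rewrite bigA_distr; apply: eq_bigr => J _; rewrite big_mkcond.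
Qed.

(** Forcing [i] into [J] replaces the factor [1 + a i] by [a i], encoded by the option weight
    [(j != i)%:R] for leaving [j] out; the removed factor is at least 1. *)
Lemma sum_prod_subsets_containing (i : I) :
  \sum_(J : {set I} | i \in J) \prod_(j in J) a j <= a i * \prod_j (1 + a j).
Proof.
have -> : \sum_(J : {set I} | i \in J) \prod_(j in J) a j =
    \prod_j (a j + (j != i)%:R).
  rewrite bigA_distr big_mkcond; apply: eq_bigr => J _.
  case: ifPn => iJ; last first.
    by rewrite (bigD1 i) //= (negPf iJ) eqxx mul0r.
  rewrite big_mkcond; apply: eq_bigr => j _; case: ifPn => // jJ.
  by rewrite (_ : j != i) //; apply: contraNneq jJ => ->.
rewrite (bigD1 i) //= eqxx addr0 ler_wpM2l //.
rewrite [leRHS](bigD1 i) //= -[leLHS]mul1r ler_pM // ?lerDl ?prodr_ge0 //.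
  by move=> j ->; rewrite addr_ge0.
by apply: ler_prod => j ji; rewrite ji addr_ge0 //= addrC.
Qed.

(** Markov's inequality before normalisation: exchanging sums and bounding the mass of the sets
    containing each [i] shows that the mean of [\sum_(i in J) g i] is at most [\sum_i a i * g i]. *)
Lemma subset_markov (K : R) : 0 < K ->
  \prod_i (1 + a i) * (1 - (\sum_i a i * g i) / K) <=
  \sum_(J : {set I} | \sum_(i in J) g i < K) \prod_(i in J) a i.
Proof.
move=> K0; set Z := \prod_i _.
have w0 (J : {set I}) : 0 <= \prod_(i in J) a i by exact: prodr_ge0.
have mean : \sum_(J : {set I}) (\prod_(i in J) a i) * \sum_(i in J) g i <=
    Z * \sum_i a i * g i.
  under eq_bigr do rewrite mulr_sumr big_mkcond.
  rewrite exchange_big mulr_sumr; apply: ler_sum => i _.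
  rewrite -big_mkcond -mulr_suml mulrA ler_wpM2r // mulrC.
  exact: sum_prod_subsets_containing.
rewrite mulrBr mulr1 -[X in X - _]sum_prod_subsets.
rewrite (bigID (fun J : {set I} => \sum_(i in J) g i < K)) /=.
rewrite lerBlDr lerD2l mulrA ler_pdivlMr //; apply: le_trans mean.
rewrite mulr_suml big_mkcond; apply: ler_sum => J _.
case: ifPn; last by rewrite mulr_ge0 // sumr_ge0.
by rewrite -leNgt => KJ; rewrite ler_wpM2l.
Qed.

End RandomSubset.

(** * Finiteness of the smooth sums and increments of [smooth_distr] *)

Lemma smooth_nat_le_truncn (R : realType) (y : R) (n p : nat) :
  smooth_nat y n -> prime p -> (p %| n)%N -> (p <= Num.truncn y)%N.
Proof.
move=> [_ sn] pp pn; have py := sn p pp pn.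
by rewrite truncn_ge_nat // (le_trans _ py).
Qed.

Lemma sum_geometric_half_le (R : realType) (k : nat) :
  \sum_(i < k) (2^-1 : R) ^+ i <= 2.
Proof.
suff -> : \sum_(i < k) (2^-1 : R) ^+ i = 2 - 2 * 2^-1 ^+ k.
  by rewrite gerDl oppr_le0 mulr_ge0 // exprn_ge0.
elim: k => [|k IH]; first by rewrite big_ord0 expr0 mulr1 subrr.
by rewrite big_ord_recr /= IH exprS; field.
Qed.

(* A y-smooth n is determined by its exponents v_p(n), p <= y, and
   1/n <= \prod_(p <= y) 2 ^ (- v_p(n)); summing over all exponent vectors gives
   a product of at most y + 1 geometric series. *)
Lemma sum_inv_smooth_le (R : realType) (y : R) (s : seq nat) :
  uniq s -> (forall n, n \in s -> smooth_nat y n) ->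
  \sum_(n <- s) (n%:R : R)^-1 <= 2 ^+ (Num.truncn y).+1.
Proof.
move=> us ss; set Y := Num.truncn y.
(* As [logn p n < n], all exponents are at most [K], and exponent vectors form a finite type. *)
pose K := \max_(n <- s) n.
have logK n p : n \in s -> (logn p n < K.+1)%N.
  move=> ns; rewrite ltnS (leq_trans _ (leq_bigmax_seq _ ns _)) //.
  have [n0 _] := ss n ns; rewrite ltnW // (leq_trans (ltn_logl _ n0)) //.
pose v n : {ffun 'I_Y.+1 -> 'I_K.+1} := [ffun p : 'I_Y.+1 => inord (logn p n)].
pose h (e : {ffun 'I_Y.+1 -> 'I_K.+1}) : R := \prod_p 2^-1 ^+ e p.
have h0 e : 0 <= h e by apply: prodr_ge0 => p _; rewrite exprn_ge0.
apply: (@le_trans _ _ (\sum_(n <- s) h (v n))).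
  rewrite big_seq [leRHS]big_seq; apply: ler_sum => n ns.
  have [n0 _] := ss n ns.
  rewrite /h; under eq_bigr do rewrite ffunE inordK ?logK // exprVn -natrX.
  rewrite prodfV -natr_prod lef_pV2 ?posrE ?ltr0n //; last first.
    by apply: prodn_gt0 => p; rewrite expn_gt0.
  rewrite ler_nat; have /(dvdn_leq n0) :
      (\prod_(0 <= p < Y.+1 | prime p) p ^ logn p n %| n)%N.
    apply: (prod_prime_powers_dvd (e := logn^~ n)) => p _ pp.
    by rewrite pfactor_dvdn.
  apply: leq_trans; rewrite big_mkord [leqRHS]big_mkcond leq_prod //= => p _.
  case: ifPn => pp; first case: (logn p n) => // k.
    by rewrite leq_exp2r ?prime_gt1.
  by rewrite lognE (negPf pp).
rewrite -(big_map v xpredT h) big_uniq /=; last first.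
  rewrite map_inj_in_uniq // => m n ms ns vmn.
  have [m0 _] := ss m ms; have [n0 _] := ss n ns.
  apply: eqn_from_log => // p.
  have [pY|Yp] := leqP p Y.
    have := congr1 (fun e : {ffun 'I_Y.+1 -> 'I_K.+1} => val (e (inord p))) vmn.
    by rewrite !ffunE /= inordK // !inordK ?logK.
  have big k : k \in s -> logn p k = 0%N.
    move=> ks; rewrite lognE; case: and3P => // -[pp _ pk].
    by have := smooth_nat_le_truncn (ss k ks) pp pk; rewrite leqNgt Yp.
  by rewrite !big.
apply: (@le_trans _ _ (\sum_e h e)).
  rewrite big_mkcond; apply: ler_sum => e _; by case: ifP.
rewrite -(bigA_distr_bigA (fun _ (k : 'I_K.+1) => (2^-1 : R) ^+ k)) /=.
rewrite -[X in 2 ^+ X]card_ord -prodr_const; apply: ler_prod => p _.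
by rewrite sumr_ge0 ?sum_geometric_half_le // => i _; rewrite exprn_ge0.
Qed.

Lemma esum_smooth_le (R : realType) (y : R) (X : set nat) :
  (\esum_(n in smooth_nat y `&` X) ((n%:R : R)^-1)%:E <=
   (2 ^+ (Num.truncn y).+1)%:E)%E.
Proof.
apply: ge_ereal_sup => _ [A [finA AX] <-].
rewrite fsbig_finite // sumEFin lee_fin.
apply: sum_inv_smooth_le (finmap.fset_uniq _) _ => n.
by rewrite in_fset_set // => /set_mem/AX[].
Qed.

Lemma esum_smooth_fin_num (R : realType) (y : R) (X : set nat) :
  (\esum_(n in smooth_nat y `&` X) ((n%:R : R)^-1)%:E)%E \is a fin_num.
Proof.
rewrite ge0_fin_numE ?(le_lt_trans (esum_smooth_le y X)) ?ltry //.
by apply: esum_ge0 => n _; rewrite lee_fin.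
Qed.

Lemma prod_prime_1B_inv_itv (R : realType) (n : nat) :
  0 <= \prod_(p < n | prime p) (1 - (p%:R : R)^-1) <= 1.
Proof.
have h (p : 'I_n) : prime p -> 0 <= 1 - (p%:R : R)^-1 <= 1.
  move=> pp; rewrite gerBl invr_ge0 ler0n andbT subr_ge0 invf_le1.
    by rewrite ler1n prime_gt0.
  by rewrite ltr0n prime_gt0.
rewrite prodr_ge0 /=; last by move=> p /h/andP[].
apply: (@le_trans _ _ (\prod_(p < n | prime p) 1)); last by rewrite big1_eq.
by apply: ler_prod => p /h.
Qed.

(** A bound uniform in [u] makes the set in [concentration] bounded above, so that [sup] there
    dominates every increment. *)
Lemma smooth_distr_itv (R : realType) (f : nat -> R) (y u : R) :
  0 <= smooth_distr f y u <= 2 ^+ (Num.truncn y).+1.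
Proof.
have /andP[c0 c1] := prod_prime_1B_inv_itv R (Num.truncn y).+1.
have e0 : 0 <= fine (\esum_(n in smooth_nat y `&` [set n | (f n <= u)%R])
    ((n%:R : R)^-1)%:E)%E.
  by apply/fine_ge0/esum_ge0 => n _; rewrite lee_fin.
rewrite /smooth_distr mulr_ge0 //= -[leRHS]mul1r ler_pM //.
rewrite -lee_fin fineK ?esum_smooth_fin_num //; exact: esum_smooth_le.
Qed.

Lemma smooth_distr_sub_ge (R : realType) (f : nat -> R) (y a b : R)
    (s : seq nat) :
  a <= b -> uniq s -> (forall n, n \in s -> smooth_nat y n /\ a < f n <= b) ->
  (\prod_(p < (Num.truncn y).+1 | prime p) (1 - (p%:R)^-1)) *
    \sum_(n <- s) (n%:R : R)^-1 <=
  smooth_distr f y b - smooth_distr f y a.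
Proof.
move=> ab us ss; rewrite /smooth_distr -mulrBr.
have /andP[c0 _] := prod_prime_1B_inv_itv R (Num.truncn y).+1.
rewrite ler_wpM2l // lerBrDl -lee_fin EFinD !fineK ?esum_smooth_fin_num //.
rewrite [leRHS](esumID [set n | f n <= a]) => [|n _]; last by rewrite lee_fin.
rewrite leeD //.
  suff -> : smooth_nat y `&` [set n | f n <= b] `&` [set n | f n <= a] =
    smooth_nat y `&` [set n | f n <= a] by [].
  apply/seteqP; split=> n [] => [[sn _] na|sn na]; split=> //.
  by split=> //; exact: le_trans ab.
apply: esum_ge; exists [set` s].
  split=> [|n /= /ss[sn /andP[an nb]]]; first exact: finite_seq.
  by split=> //=; apply/negP; rewrite -ltNge.
by rewrite -fsbig_seq // sumEFin.
Qed.

Lemma concentration_telescope (R : realType) (G : R -> R) (B eps a : R)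
    (n : nat) :
  (forall u, 0 <= G u <= B) ->
  G (a + n%:R * eps) - G a <= n%:R * concentration G eps.
Proof.
move=> GB; pose v k := G (a + k%:R * eps).
have -> : G (a + n%:R * eps) - G a = \sum_(0 <= k < n) (v k.+1 - v k).
  by rewrite telescope_sumr // /v mul0r addr0.
rewrite mulr_natl -[X in _ *+ X]subn0 -sumr_const_nat; apply: ler_sum => k _.
apply: ub_le_sup.
  exists B => _ [u _ <-]; have /andP[_ h] := GB (u + eps).
  by have /andP[h' _] := GB u; lra.
by exists (a + k%:R * eps) => //; rewrite /v -natr1 mulrDl mul1r addrA.
Qed.

(** [\esum] is a supremum over finite subsets, so it dominates each finite sum, whatever the signs
    of [F]. *)
Lemma sum_le_esum (R : realType) (A : set nat) (F : nat -> R) (B : R)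
    (Q : pred nat) (n : nat) :
  (forall p, Q p -> A p) -> (\esum_(p in A) (F p)%:E <= B%:E)%E ->
  \sum_(0 <= p < n | Q p) F p <= B.
Proof.
move=> QA; rewrite -lee_fin; apply: le_trans.
apply: esum_ge; exists [set` [seq p <- index_iota 0 n | Q p]].
  split=> [|p /=]; first exact: finite_seq.
  by rewrite mem_filter => /andP[/QA].
by rewrite -fsbig_seq ?filter_uniq ?iota_uniq // sumEFin big_filter.
Qed.

(** * Squarefree integers as sets of primes *)

Section PrimeSubsets.
Variable N : nat.
Implicit Type J : {set 'I_N}.

Lemma prod_set_primesE J :
  (\prod_(i in J) i = \prod_(p <- map val (enum J)) p)%N.
Proof. by rewrite big_map big_enum. Qed.

Lemma all_prime_set J :
  {in J, forall i : 'I_N, prime i} -> all prime (map val (enum J)).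
Proof.
by move=> pJ; apply/allP => _ /mapP[i + ->]; rewrite mem_enum => /pJ.
Qed.

(** The set is recovered as the prime divisors of its product, so distinct sets give distinct
    integers. *)
Lemma prod_set_primes_inj :
  {in [pred J : {set 'I_N} | [forall i in J, prime i]] &,
    injective (fun J : {set 'I_N} => \prod_(i in J) i)%N}.
Proof.
move=> J1 J2 /forall_inP p1 /forall_inP p2 eq12; apply/setP => i.
have key J : {in J, forall i : 'I_N, prime i} -> prime i ->
    (i \in J) = (i %| \prod_(j in J) j)%N.
  move=> pJ pi.
  rewrite prod_set_primesE prime_dvd_prod_primes ?all_prime_set //.
  by rewrite mem_map ?mem_enum //; exact: val_inj.
have [pi|npi] := boolP (prime i); first by rewrite !key // eq12.
by rewrite (contraNF (p1 i) npi) (contraNF (p2 i) npi).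
Qed.

Lemma additive_arith_prod_set (R : realType) (f : nat -> R) J :
  additive_arith f -> {in J, forall i : 'I_N, prime i} ->
  f (\prod_(i in J) i)%N = \sum_(i in J) f i.
Proof.
move=> fadd pJ; rewrite prod_set_primesE additive_arith_prod_primes //.
- by rewrite big_map big_enum.
- by rewrite map_inj_uniq ?enum_uniq //; exact: val_inj.
- exact: all_prime_set.
Qed.

End PrimeSubsets.

Lemma smooth_prod_set (R : realType) (y : R) (J : {set 'I_(Num.truncn y).+1}) :
  0 <= y -> {in J, forall i : 'I__, prime i} ->
  smooth_nat y (\prod_(i in J) i)%N.
Proof.
move=> y0 pJ; split=> [|p pp].
  by apply: prodn_cond_gt0 => i /pJ/prime_gt0.
rewrite prod_set_primesE prime_dvd_prod_primes ?all_prime_set //.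
by move=> /mapP[i _ ->]; rewrite -truncn_ge_nat // -ltnS ltn_ord.
Qed.

(* Lower bound by the n that are squarefree products of primes in T; given this
   event, |f n| has mean at most E and Markov's inequality applies. *)
Lemma smooth_distr_sub_ge_squarefree (R : realType) (f : nat -> R) (y K E : R)
    (T : pred nat) :
  additive_arith f -> 0 <= y -> 0 < K ->
  \sum_(0 <= p < (Num.truncn y).+1 | prime p && T p) `|f p| / p%:R <= E ->
  (\prod_(p < (Num.truncn y).+1 | prime p) (1 - (p%:R)^-1)) *
    (\prod_(0 <= p < (Num.truncn y).+1 | prime p && T p) (1 + (p%:R)^-1)) *
    (1 - E / K) <=
  smooth_distr f y K - smooth_distr f y (- K).
Proof.
move=> fadd y0 K0 fE; set Y := Num.truncn y in fE *.
(* Zero weight off the primes of [T] lets the random subset range over all of ['I_Y.+1]: a set with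
   any other element has weight 0. *)
pose a (i : 'I_Y.+1) : R := if prime i && T i then (i%:R)^-1 else 0.
pose g (i : 'I_Y.+1) : R := `|f i|.
have a0 i : 0 <= a i by rewrite /a; case: ifP => //; rewrite invr_ge0.
have g0 i : 0 <= g i by exact: normr_ge0.
pose good (J : {set 'I_Y.+1}) :=
  [forall i in J, prime i && T i] && (\sum_(i in J) g i < K).
pose r := [seq J <- index_enum {set 'I_Y.+1} | good J].
pose s := [seq (\prod_(i in (J : {set 'I_Y.+1})) i)%N | J <- r].
have pgood J : J \in r ->
    {in J, forall i : 'I_Y.+1, prime i} /\ \sum_(i in J) g i < K.
  rewrite mem_filter => /andP[/andP[/forall_inP pT gK] _]; split=> // i iJ.
  by have /andP[] := pT i iJ.
have us : uniq s.
  rewrite map_inj_in_uniq ?filter_uniq ?index_enum_uniq // => J1 J2 h1 h2.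
  apply: prod_set_primes_inj; apply/forall_inP.
    by have [] := pgood J1 h1.
  by have [] := pgood J2 h2.
have ss n : n \in s -> smooth_nat y n /\ - K < f n <= K.
  move=> /mapP[J /pgood[pJ gK] ->]; split; first exact: smooth_prod_set.
  rewrite additive_arith_prod_set //.
  have := le_lt_trans (ler_norm_sum _ _ _) gK.
  by rewrite ltr_norml => /andP[-> /ltW].
have c0 := andP (prod_prime_1B_inv_itv R Y.+1).
apply: le_trans (smooth_distr_sub_ge _ us ss); last by lra.
rewrite -mulrA ler_wpM2l //; first by case: c0.
have <- : \sum_(J : {set 'I_Y.+1} | \sum_(i in J) g i < K) \prod_(i in J) a i =
    \sum_(n <- s) (n%:R : R)^-1.
  rewrite big_map big_filter big_mkcond [RHS]big_mkcond.
  apply: eq_bigr => J _ /=.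
  rewrite /good; case: ifPn => // gK; rewrite ?andbF ?andbT //.
  case: ifPn => [/forall_inP pT|/forall_inPn[i iJ nT]].
    by rewrite natr_prod -prodfV; apply: eq_bigr => i /pT; rewrite /a => ->.
  by rewrite (bigD1 i) //= /a (negPf nT) mul0r.
apply: le_trans (subset_markov a0 g0 K0).
have -> : \prod_(0 <= p < Y.+1 | prime p && T p) (1 + (p%:R : R)^-1) =
    \prod_i (1 + a i).
  rewrite big_mkord big_mkcond; apply: eq_bigr => i _.
  by rewrite /a; case: ifP; rewrite ?addr0.
rewrite ler_wpM2l ?prodr_ge0 // => [i _|]; first by rewrite addr_ge0.
rewrite lerD2l lerN2 ler_wpM2r ?invr_ge0 ?(ltW K0) //.
apply: le_trans fE; rewrite big_mkord [leRHS]big_mkcond le_eqVlt.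
apply/orP; left; apply/eqP/eq_bigr => i _.
by rewrite /a /g; case: ifP => _; rewrite ?mul0r // mulrC.
Qed.

(** * Choice of constants and conclusion *)

Theorem theorem3p1 (R : realType) (C1 C2 : R) (hC1 : 0 < C1) (hC2 : 0 < C2) :
  exists2 kappa : R, 0 < kappa &
    forall (f : nat -> R) (eps : R) (P : set nat) (M : R),
      additive_arith f ->
      0 < eps -> eps < 1 ->
      P `<=` [set p | prime p] ->
      2 <= M ->
      (\esum_(p in [set p | prime p /\ ~ P p]) ((p%:R : R)^-1)%:E <= C1%:E)%E ->
      (\esum_(p in [set p | P p /\ (M < p%:R)%R]) (`|f p| / p%:R)%:E
        <= (C2 * eps)%:E)%E ->
      forall y : R, M <= y ->
        kappa / ln M <= concentration (smooth_distr f y) eps.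
Proof.
(* [K0] is the constant of [sum_prime_inv_le]. [L] is an integer above [2 * C2], so Markov's
   inequality at level [L * eps] loses at most half of the mass. *)
pose K0 : R := 1 + ln 16 / ln 2 - ln (ln 2).
pose L := (Num.truncn (2 * C2)).+1.
have L0 : 0 < L%:R :> R by rewrite ltr0n.
have LC : 2 * C2 < L%:R by exact: truncnS_gt.
(* The divisor is 2, for the half kept by Markov's inequality, times [2 * L], the number of
   intervals of length [eps]. *)
exists (expR (- (K0 + C1 + 1)) / (4 * L%:R)).
  by rewrite divr_gt0 ?expR_gt0 ?mulr_gt0.
move=> f eps P M fadd eps0 _ _ M2 hP hf y My.
have M0 : 0 <= M by lra.
have y0 : 0 <= y by lra.
set m := Num.truncn M; set Y := Num.truncn y.
have m2 : (2 <= m)%N by rewrite truncn_ge_nat.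
have mY : (m <= Y)%N by exact: le_truncn.
pose T p := (m < p)%N && (p \in P).
have hT : \sum_(0 <= p < Y.+1 | prime p && T p) `|f p| / p%:R <= C2 * eps.
  apply: sum_le_esum hf => p /andP[_ /andP[mp /set_mem Pp]]; split=> //=.
  by rewrite -truncn_lt_nat.
(* A prime outside [T] is at most [m] or lies outside [P]: Mertens' bound handles the former, the
   hypothesis with [C1] the latter. *)
have hnT : \sum_(0 <= p < Y.+1 | prime p && ~~ T p) (p%:R : R)^-1 <=
    ln (ln m%:R) + K0 + C1.
  have hm : \sum_(0 <= p < Y.+1 | prime p && (p < m.+1)%N) (p%:R : R)^-1 <=
      ln (ln m%:R) + K0.
    by rewrite -big_nat_widen ?ltnS //; exact: sum_prime_inv_le.
  have hn : \sum_(0 <= p < Y.+1 | prime p && (p \notin P)) (p%:R : R)^-1 <= C1.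
    apply: sum_le_esum hP => p /andP[pp pP]; split=> // Pp.
    by move: pP; rewrite mem_set.
  apply: le_trans (lerD hm hn).
  rewrite big_mkcondr [X in _ <= X + _]big_mkcondr [X in _ <= _ + X]big_mkcondr.
  rewrite -big_split /=; apply: ler_sum => p _.
  have p0 : 0 <= (p%:R : R)^-1 by rewrite invr_ge0.
  rewrite /T negb_and -leqNgt ltnS; case: leqP; case: (p \in P) => _ //=;
    rewrite ?addr0 ?add0r ?lerDl //.
have Keps0 : 0 < L%:R * eps by rewrite mulr_gt0.
have mass := smooth_distr_sub_ge_squarefree fadd y0 Keps0 hT.
have Q2L := concentration_telescope eps (- (L%:R * eps)) (2 * L)
  (smooth_distr_itv f y).
have eq2L : - (L%:R * eps) + (2 * L)%:R * eps = L%:R * eps :> R.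
  by rewrite natrM; ring.
rewrite eq2L in Q2L.
have half : 2^-1 <= 1 - C2 * eps / (L%:R * eps).
  rewrite -mulf_div divff ?gt_eqF // mulr1.
  have : C2 / L%:R <= 2^-1 by rewrite ler_pdivrMr //; lra.
  lra.
have euler := euler_prod_ge R Y.+1 T.
rewrite [X in X * _]big_mkord in euler.
have lnm0 : 0 < ln (m%:R : R) by rewrite ln_gt0 // ltr1n.
have lnM : ln (m%:R : R) <= ln M.
  by rewrite ler_ln ?posrE ?ltr0n ?(leq_trans _ m2) ?truncn_le //; lra.
(* The factor [expR (- ln (ln m))] is [1 / ln m], which is at least [1 / ln M] because [m <= M]. *)
have lower : expR (- (K0 + C1 + 1)) / ln M <=
    expR (- (\sum_(0 <= p < Y.+1 | prime p && ~~ T p) (p%:R : R)^-1 + 1)).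
  apply: (@le_trans _ _ (expR (- (K0 + C1 + 1)) / ln m%:R)).
    by rewrite ler_wpM2l ?expR_ge0 ?lef_pV2 ?posrE // (lt_le_trans lnm0).
  rewrite -[X in _ / X]lnK ?posrE // -expRN -expRD ler_expR; lra.
have {}lower := le_trans lower euler.
have cZ0 := le_trans (expR_ge0 _) euler.
have {}mass := le_trans (ler_wpM2l cZ0 half) mass.
have {}lower : expR (- (K0 + C1 + 1)) / ln M / 2 <=
    2 * L%:R * concentration (smooth_distr f y) eps.
  by move: Q2L; rewrite natrM; lra.
rewrite mulrAC ler_pdivrMr ?mulr_gt0 //; lra.
Qed.
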